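(* Let $n = 2^h-1$ with $h\ge 2$ and let $l \ge 2$. Let $T_{n\times l}^2$ be the graph obtained from $l$ disjoint copies $T_{n,1},\dots,T_{n,l}$ of the full binary tree on $n$ vertices by adding, for each $1\le j\le l-1$, a single edge joining the root of $T_{n,j}$ to the root of $T_{n,j+1}$ (so $T_{n\times l}^2$ has $nl$ vertices). Then $$\frac{2}{(nl-1)\bigl(l\log_2(n-1)-1\bigr)} \le \lambda_2(T_{n\times l}^2) \le \frac{l}{n-1}.$$
   Context: All graphs are finite, simple and unweighted. A full binary tree on $n=2^h-1$ vertices is the rooted tree in which every non-leaf vertex has exactly two children and all leaves are at depth $h-1$ from the root; its root is the vertex that is an ancestor of all other vertices. For a graph $G$ with adjacency matrix $A$ and diagonal degree matrix $D$, the graph Laplacian is $L_G = D - A$, with eigenvalues $0=\lambda_1 \le \lambda_2 \le \dots$; $\lambda_2(G)$ denotes the second smallest eigenvalue of $L_G$. *)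

(* Defs.v *)
From HB Require Import structures.
From mathcomp Require Import all_boot all_order all_algebra.
From mathcomp Require Import reals exp.
Set Implicit Arguments. Unset Strict Implicit. Unset Printing Implicit Defensive.
Import Order.TTheory GRing.Theory Num.Theory.
Local Open Scope ring_scope.

(* Full binary tree on n vertices in heap indexing: vertex 0 is the root,
   the children of vertex b are 2b+1 and 2b+2 (when < n).  For n = 2^h - 1
   this is exactly the full binary tree of height h-1. *)
Definition bt_adj (b d : nat) : bool :=
  [|| d == b.*2.+1, d == b.*2.+2, b == d.*2.+1 | b == d.*2.+2].

(* T^2_{n x l}: vertex set {0,..,l*n-1}; vertex i is vertex (i %% n) of
   copy (i %/ n).  Edges: tree edges inside each copy, plus the edge joining
   the roots of consecutive copies j, j+1. *)
Definition Tnl_adj (n l : nat) (i j : 'I_(l * n)) : bool :=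
  let a := (i %/ n)%N in let b := (i %% n)%N in
  let c := (j %/ n)%N in let d := (j %% n)%N in
  ((a == c) && bt_adj b d) ||
  [&& b == 0%N, d == 0%N & (c == a.+1) || (a == c.+1)].

Definition laplacian (R : ringType) (N : nat) (adj : rel 'I_N) : 'M[R]_N :=
  \matrix_(i, j) (if i == j then (#|[set k | adj i k]|)%:R
                  else - (adj i j)%:R).

Definition sorted_spectrum (R : realType) (N : nat) (M : 'M[R]_N) (s : seq R) :=
  sorted <=%R s /\ char_poly M = \prod_(x <- s) ('X - x%:P).

Definition log2 (R : realType) (x : R) : R := ln x / ln 2.
Arguments Tnl_adj : clear implicits.

(* Main.v *)
Require Import Defs.
From HB Require Import structures.
From mathcomp Require Import all_boot all_order all_algebra.
From mathcomp Require Import reals exp.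
From mathcomp Require Import perm complex ring lra zify.
Set Implicit Arguments. Unset Strict Implicit. Unset Printing Implicit Defensive.
Import Order.TTheory GRing.Theory Num.Theory.
Local Open Scope ring_scope.

(* Both bounds go through the variational characterisation of the second
   eigenvalue.  The upper bound tests the Dirichlet energy on the span of the
   constants and the indicator of one end copy.
   For the lower bound, shift a vector orthogonal to the constants so that its
   values at the two middle roots are opposite (zero at the middle root when l
   is odd); this does not decrease its norm.  With the middle of the path of
   roots thus grounded, the function g solving "Laplacian g = 1" is positive,
   and Barta's inequality bounds the smallest eigenvalue below by 1 / max g.
   On the path g grows to at most n l^2 / 8, and inside a tree it increases
   along each edge by the number of vertices below it, n - h in total; so the
   second eigenvalue is at least 1 / (n l^2 / 8 + n - h), which is enough. *)

(** * Variational bounds on the second eigenvalue *)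

Lemma Re_mulJ (R : rcfType) (x y : R[i]) (a : R) :
  complex.Re (x * a%:C%C * Num.conj y) =
  a * (complex.Re x * complex.Re y + complex.Im x * complex.Im y).
Proof. case: x => x1 x2; case: y => y1 y2 /=. ring. Qed.

Lemma Re_sum (R : rcfType) (I : Type) (r : seq I) (P : pred I) (F : I -> R[i]) :
  complex.Re (\sum_(i <- r | P i) F i) = \sum_(i <- r | P i) complex.Re (F i).
Proof. exact: (big_morph _ (@raddfD _ _ (@complex.Re R : Rcomplex R -> R))). Qed.

Lemma Im_sum (R : rcfType) (I : Type) (r : seq I) (P : pred I) (F : I -> R[i]) :
  complex.Im (\sum_(i <- r | P i) F i) = \sum_(i <- r | P i) complex.Im (F i).
Proof. exact: (big_morph _ (@raddfD _ _ (@complex.Im R : Rcomplex R -> R))). Qed.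

Definition quadf (R : nzRingType) N (A : 'M[R]_N) (x : 'rV[R]_N) : R :=
  (x *m A *m x^T) 0 0.

Definition Remx (R : rcfType) N (z : 'rV[R[i]]_N) : 'rV[R]_N := map_mx (@complex.Re R) z.
Definition Immx (R : rcfType) N (z : 'rV[R[i]]_N) : 'rV[R]_N := map_mx (@complex.Im R) z.

Lemma quadfE (R : nzRingType) N (A : 'M[R]_N) x :
  quadf A x = \sum_i \sum_j x 0 i * A i j * x 0 j.
Proof.
rewrite /quadf mxE exchange_big; apply: eq_bigr => j _.
by rewrite !mxE big_distrl.
Qed.

(** As [A] is real, the mixed products of real and imaginary parts do not reach the real part. So a
    complex diagonalisation speaks about real quadratic forms. *)
Lemma Re_sesq (R : rcfType) N (A : 'M[R]_N) (z : 'rV[R[i]]_N) :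
  complex.Re ((z *m map_mx (real_complex R) A *m map_mx Num.conj z^T) 0 0) =
  quadf A (Remx z) + quadf A (Immx z).
Proof.
rewrite !quadfE !mxE Re_sum exchange_big [in X in _ + X]exchange_big -big_split /=; apply: eq_bigr => j _.
rewrite !mxE big_distrl Re_sum -big_split; apply: eq_bigr => i _.
rewrite !mxE Re_mulJ.
rewrite /=; ring.
Qed.


Lemma char_poly_conj (F : fieldType) N (P D : 'M[F]_N) :
  P \in unitmx -> char_poly (invmx P *m D *m P) = char_poly D.
Proof.
move=> Pu; rewrite /char_poly.
have -> : char_poly_mx (invmx P *m D *m P) =
    map_mx polyC (invmx P) *m char_poly_mx D *m map_mx polyC P.
  rewrite /char_poly_mx !map_mxM mulmxBr mulmxBl; congr (_ - _).
  by rewrite scalar_mxC -mulmxA -map_mxM mulVmx // map_mx1 mulmx1.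
rewrite !det_mulmx mulrAC -det_mulmx -map_mxM mulVmx // map_mx1 det1 mul1r //.
Qed.

Local Open Scope sesquilinear_scope.
(** The spectral theorem lists the eigenvalues in an order of its own; the permutation matrix that
    reorders them is unitary and is absorbed into [U]. *)
Lemma unitary_diag_perm (C : numClosedFieldType) N (P : 'M[C]_N) (p : {perm 'I_N})
    (d e : 'rV[C]_N) :
  P \is unitarymx -> (forall i, d 0 i = e 0 (p i)) ->
  exists2 U : 'M[C]_N, U \is unitarymx &
    invmx P *m diag_mx d *m P = U *m diag_mx e *m U^t*.
Proof.
move=> PU pE.
have permU : perm_mx p *m (perm_mx p)^t* = 1%:M :> 'M[C]_N.
  by rewrite tr_perm_mx map_perm_mx -perm_mxM mulgV perm_mx1.
exists (P^t* *m perm_mx p).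
  by rewrite mul_unitarymx ?trmxC_unitary //; apply/unitarymxP.
rewrite invmx_unitary // trmx_mul map_mxM trmxCK !mulmxA; congr (_ *m _).
rewrite -!mulmxA; congr (_ *m _).
apply/matrixP=> i j.
rewrite tr_perm_mx map_perm_mx -col_permE -row_permE.
rewrite !mxE pE; case: eqVneq => [->|ne]; first by rewrite eqxx.
by rewrite (inj_eq perm_inj) (negPf ne).
Qed.

(** A real symmetric matrix is Hermitian over [R[i]], hence unitarily diagonalisable; comparing
    characteristic polynomials shows its diagonal to be [s] up to order. *)
Lemma symmetric_spectral (R : rcfType) N (A : 'M[R]_N) (s : seq R) :
  A^T = A -> char_poly A = \prod_(x <- s) ('X - x%:P) ->
  exists2 U : 'M[R[i]]_N, U \is unitarymx &
   map_mx (real_complex R) A = U *m map_mx (real_complex R) (diag_mx (\row_i s`_i)) *m U^t*.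
Proof.
move=> Asym cA.
set B := map_mx _ A.
have Bherm : B \is normalmx.
  apply: hermitian_normalmx; apply/is_hermitianmxP.
  rewrite expr0 scale1r; apply/matrixP=> i j; rewrite !mxE -[in LHS]Asym mxE.
  exact/esym/conjc_real.
have /orthomx_spectralP := Bherm.
set P := spectralmx B; set d := spectral_diag B.
have PU : P \is unitarymx := spectral_unitarymx B.
move=> BE.
have sz : size s = N.
  have := congr1 (fun p : {poly R} => size p) cA.
  by rewrite size_char_poly size_prod_XsubC => -[].
have cB : \prod_(x <- codom (d 0)) ('X - x%:P) = \prod_(x <- map (real_complex R) s) ('X - x%:P).
  have := congr1 (map_poly (real_complex R)) cA.
  rewrite map_char_poly rmorph_prod /= big_map => cB.
  transitivity (char_poly B); last first.
    by rewrite cB; apply: eq_bigr => x _; rewrite map_polyXsubC.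
  rewrite [in RHS]BE char_poly_conj ?unitarymx_unit // char_poly_trig; last exact: diag_mx_is_trig.
  rewrite big_map enumT; apply: eq_bigr => i _.
  by rewrite !mxE eqxx.
have pe := prod_XsubC_eq cB.
have szs : size (map (real_complex R) s) == N by rewrite size_map sz.
have [p pE] : exists p : {perm 'I_N}, forall i, d 0 i = (s`_(p i))%:C%C.
  have /tuple_permP[p pE] : perm_eq (codom (d 0)) (Tuple szs) by [].
  exists p => i; have := congr1 (fun t => t`_i) pE.
  rewrite -tnth_nth tnth_mktuple (tnth_nth 0) /= (nth_map 0) ?sz //.
  move=> <-; rewrite codomE (nth_map i) ?size_enum_ord // nth_ord_enum //.
have dE i : d 0 i = map_mx (real_complex R) (\row_i s`_i) 0 (p i) by rewrite !mxE.
have [U Uu UE] := unitary_diag_perm PU dE.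
exists U; first exact: Uu.
by rewrite map_diag_mx -UE.
Qed.

Definition sqnormc (R : rcfType) (w : R[i]) : R := complex.Re w ^+ 2 + complex.Im w ^+ 2.

Lemma sqnormc_ge0 (R : rcfType) (w : R[i]) : 0 <= sqnormc w.
Proof. by rewrite addr_ge0 ?sqr_ge0. Qed.

Lemma sqnormc_eq0 (R : rcfType) (w : R[i]) : (sqnormc w == 0) = (w == 0).
Proof.
by rewrite /sqnormc paddr_eq0 ?sqr_ge0 // !sqrf_eq0 eq_complex.
Qed.

(** In the coordinates [z *m U] both forms are diagonal. Real and imaginary parts go together
    because [U] is complex. *)
Lemma symmetric_spectral_quadf (R : rcfType) N (A : 'M[R]_N) (s : seq R) :
  A^T = A -> char_poly A = \prod_(x <- s) ('X - x%:P) ->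
  exists2 U : 'M[R[i]]_N, U \is unitarymx & forall (mu : R) z,
   quadf A (Remx z) + quadf A (Immx z) - mu * (quadf 1%:M (Remx z) + quadf 1%:M (Immx z)) =
   \sum_(i < N) (s`_i - mu) * sqnormc ((z *m U) 0 i).
Proof.
move=> Asym cA; have [U Uu UE] := symmetric_spectral Asym cA.
exists U => // mu z.
have diagE (D : 'rV[R]_N) : quadf (diag_mx D) (Remx (z *m U)) + quadf (diag_mx D) (Immx (z *m U)) =
    \sum_i D 0 i * sqnormc ((z *m U) 0 i).
  rewrite !quadfE -big_split /=; apply: eq_bigr => i _.
  rewrite (bigD1 i) //= [in X in _ + X](bigD1 i) //= !big1 ?addr0; first last.
  - by move=> j ne; rewrite !mxE eq_sym (negPf ne) mulr0 mul0r.
  - by move=> j ne; rewrite !mxE eq_sym (negPf ne) mulr0 mul0r.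
  rewrite ![in LHS]mxE eqxx mulr1n /sqnormc !mxE; ring.
have UUt : U *m U^t* = 1%:M by apply/unitarymxP.
transitivity (\sum_(i < N) s`_i * sqnormc ((z *m U) 0 i) - mu * \sum_i 1 * sqnormc ((z *m U) 0 i)).
  congr (_ - _ * _).
    rewrite -Re_sesq UE.
    transitivity (\sum_i (\row_j s`_j) 0 i * sqnormc ((z *m U) 0 i)); last first.
      by apply: eq_bigr => i _; rewrite !mxE.
    rewrite -diagE -Re_sesq trmx_mul map_mxM !mulmxA //.
  rewrite -Re_sesq map_mx1 mulmx1.
  transitivity (\sum_i (const_mx 1 : 'rV[R]_N) 0 i * sqnormc ((z *m U) 0 i)); last first.
      by apply: eq_bigr => i _; rewrite !mxE.
  rewrite -diagE -Re_sesq diag_const_mx map_mx1 mulmx1 trmx_mul map_mxM mulmxA.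
  by rewrite -(mulmxA z) UUt mulmx1.
rewrite mulr_sumr -sumrB; apply: eq_bigr => i _; ring.
Qed.

Lemma sorted_spectrum_size (R : realType) N (A : 'M[R]_N) (s : seq R) :
  sorted_spectrum A s -> size s = N.
Proof.
case=> _ /(congr1 (fun p : {poly R} => size p)).
by rewrite size_char_poly size_prod_XsubC => -[].
Qed.

(** Half of Courant-Fischer: the span of the first two eigenvectors contains a nonzero vector
    orthogonal to [w]; if the second eigenvalue were below [c], that vector would violate the
    hypothesis. *)
Lemma second_eigenvalue_ge (R : realType) N (A : 'M[R]_N) (s : seq R) (w : 'rV[R]_N) (c : R) :
  (1 < N)%N -> A^T = A -> sorted_spectrum A s ->
  (forall x, x *m w^T = 0 -> c * quadf 1%:M x <= quadf A x) -> c <= s`_1.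
Proof.
case: N A w => [//|[//|N]] A w _ Asym specA Ac; have sz := sorted_spectrum_size specA.
case: specA => ss cA.
have [U Uu UE] := symmetric_spectral_quadf Asym cA.
rewrite leNgt; apply/negP => lt_s_c.
have [u uE] : exists u, u = U^t* *m map_mx (real_complex R) w^T by exists (U^t* *m map_mx (real_complex R) w^T).
(* [u] holds the coordinates of [w] in the eigenbasis; [t] solves one linear equation in the first
   two coordinates. *)
have [t [t0 tu t2]] : exists t : 'rV[R[i]]_N.+2, [/\ t != 0, t *m u = 0 &
    forall i : 'I_N.+2, (1 < i)%N -> t 0 i = 0].
  have i0 : (0%R : 'I_N.+2) = @Ordinal N.+2 0 isT by apply/val_inj.
  have i1 : (1%R : 'I_N.+2) = @Ordinal N.+2 1 isT by apply/val_inj.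
  have [u0|u0] := eqVneq (u 0 0) 0.
    exists (delta_mx 0 0); split.
    - by apply/negP => /eqP/matrixP/(_ 0 0)/eqP; rewrite !mxE oner_eq0.
    - by rewrite -rowE; apply/rowP => j; rewrite ord1 !mxE.
    - by move=> i i_gt1; rewrite mxE /= i0; case: eqP i_gt1 => // ->.
  exists (u 1 0 *: delta_mx 0 0 - u 0 0 *: delta_mx 0 1); split.
  - apply/negP => /eqP/matrixP/(_ 0 1)/eqP; rewrite !mxE /=.
    by rewrite mulr0 mulr1 sub0r oppr_eq0 (negPf u0).
  - rewrite mulmxBl -!scalemxAl -!rowE; apply/rowP => j; rewrite ord1.
    by rewrite 6!mxE mulrC subrr mxE.
  - move=> i i_gt1; rewrite !mxE /= i0 i1.
    by case: i i_gt1 => -[|[|i]] //= lt _; rewrite !mulr0 subrr.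
pose z := t *m U^t*.
have zU : z *m U = t.
  rewrite -mulmxA -invmx_unitary // mulVmx ?mulmx1 //; exact: unitarymx_unit.
have zw : z *m map_mx (real_complex R) w^T = 0 by rewrite -mulmxA -uE.
clearbody z.
have Rw : Remx z *m w^T = 0.
  apply/matrixP=> i j; have /matrixP/(_ i j)/(congr1 (@complex.Re R)) := zw.
  rewrite !mxE Re_sum /= => {2}<-; apply: eq_bigr => k _.
  by rewrite !mxE; case: (z i k) => a b /=; rewrite mulr0 subr0.
have Iw : Immx z *m w^T = 0.
  apply/matrixP=> i j; have /matrixP/(_ i j)/(congr1 (@complex.Im R)) := zw.
  rewrite !mxE Im_sum /= => {2}<-; apply: eq_bigr => k _.
  by rewrite !mxE; case: (z i k) => a b /=; rewrite mulr0 add0r mulrC.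
have := UE c z; rewrite zU => sumE.
have := lerD (Ac _ Rw) (Ac _ Iw); rewrite -mulrDr -subr_ge0 sumE => sum_ge0.
have terms (i : 'I_N.+2) : 0 <= (c - s`_i) * sqnormc (t 0 i).
  have [i_gt1|] := ltnP 1 i.
    by rewrite t2 // (eqP (_ : sqnormc 0 == 0)) ?mulr0 // sqnormc_eq0.
  move=> i_le1; apply: mulr_ge0; last exact: sqnormc_ge0.
  rewrite subr_ge0 (le_trans _ (ltW lt_s_c)) //.
  by apply: sorted_leq_nth => //; rewrite ?inE ?sz //; apply: le_trans.
(* Termwise the sum is at least 0, and by the hypothesis on [A] at most 0, so every term
   vanishes. *)
have t_eq0 : \sum_(i < N.+2) (c - s`_i) * sqnormc (t 0 i) == 0.
  rewrite eq_le sumr_ge0 // andbT -oppr_ge0 -sumrN.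
  by under eq_bigr do rewrite -mulNr opprB.
move: t_eq0; rewrite psumr_eq0 // => /allP t_eq0.
case/negP: t0; apply/eqP/rowP => i; rewrite mxE.
have [i_gt1|i_le1] := ltnP 1 i; first exact: t2.
have := t_eq0 i (mem_index_enum _); rewrite /= mulf_eq0 sqnormc_eq0 => /orP[|/eqP //].
rewrite subr_eq0 => /eqP cE; have : s`_i <= s`_1.
  by apply: sorted_leq_nth => //; rewrite ?inE ?sz //; apply: le_trans.
by rewrite -cE leNgt lt_s_c.
Qed.

(** The dual half: the complex span of [u] and [v] contains a nonzero vector with no component on
    the first eigenvector, and there the form is at least the second eigenvalue times the squared
    norm. *)
Lemma second_eigenvalue_le (R : realType) N (A : 'M[R]_N) (s : seq R) (u v : 'rV[R]_N) (mu : R) :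
  (1 < N)%N -> A^T = A -> sorted_spectrum A s ->
  (forall a b : R, a *: u + b *: v = 0 -> a = 0 /\ b = 0) ->
  (forall a b : R, quadf A (a *: u + b *: v) <= mu * quadf 1%:M (a *: u + b *: v)) ->
  s`_1 <= mu.
Proof.
case: N A u v => [//|[//|N]] A u v _ Asym specA uv Amu; have sz := sorted_spectrum_size specA.
case: specA => ss cA.
have [U Uu UE] := symmetric_spectral_quadf Asym cA.
rewrite leNgt; apply/negP => lt_mu_s.
pose uC := map_mx (real_complex R) u; pose vC := map_mx (real_complex R) v.
have [a [b [ab abU]]] : exists a b : R[i], ((a != 0) || (b != 0)) /\
    ((a *: uC + b *: vC) *m U) 0 0 = 0.
  have [u0|u0] := eqVneq ((uC *m U) 0 0) 0.
    by exists 1, 0; rewrite oner_eq0 scale1r scale0r addr0.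
  exists (- (vC *m U) 0 0), ((uC *m U) 0 0); rewrite u0 orbT; split=> //.
  rewrite mulmxDl -!scalemxAl.
  by rewrite [LHS]mxE [X in X + _]mxE [X in _ + X]mxE mulNr mulrC addNr.
pose z := a *: uC + b *: vC.
have zR : Remx z = complex.Re a *: u + complex.Re b *: v.
  by apply/rowP => j; rewrite !mxE; case: (a) (b) => ? ? [? ?] /=; ring.
have zI : Immx z = complex.Im a *: u + complex.Im b *: v.
  by apply/rowP => j; rewrite !mxE; case: (a) (b) => ? ? [? ?] /=; ring.
have sum_le0 : \sum_(i < N.+2) (s`_i - mu) * sqnormc ((z *m U) 0 i) <= 0.
  by rewrite -UE subr_le0 mulrDr lerD // ?zR ?zI.
have ge_mu (i : 'I_N.+2) : i != 0 -> mu < s`_i.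
  move=> i0; apply: (lt_le_trans lt_mu_s).
  by apply: sorted_leq_nth => //; rewrite ?inE ?sz //; [apply: le_trans | rewrite lt0n].
have terms (i : 'I_N.+2) : 0 <= (s`_i - mu) * sqnormc ((z *m U) 0 i).
  have [->|i0] := eqVneq i 0; last by rewrite mulr_ge0 ?sqnormc_ge0 // subr_ge0 ltW ?ge_mu.
  by rewrite abU (eqP (_ : sqnormc 0 == 0)) ?mulr0 // sqnormc_eq0.
have zU0 : z *m U = 0.
  have : \sum_(i < N.+2) (s`_i - mu) * sqnormc ((z *m U) 0 i) == 0 by rewrite eq_le sum_le0 sumr_ge0.
  rewrite psumr_eq0 // => /allP t_eq0; apply/rowP => i; rewrite [RHS]mxE.
  have [->|i0] := eqVneq i 0; first exact: abU.
  have := t_eq0 i (mem_index_enum _); rewrite /= mulf_eq0 sqnormc_eq0 => /orP[|/eqP //].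
  by rewrite subr_eq0 => /eqP sE; have := ge_mu i i0; rewrite sE ltxx.
have z0 : z = 0 by rewrite -[z](mulmxK (unitarymx_unit Uu)) zU0 mul0mx.
have Remx0 : Remx z = 0 by rewrite z0; apply/rowP => j; rewrite !mxE.
have Immx0 : Immx z = 0 by rewrite z0; apply/rowP => j; rewrite !mxE.
have [ra rb] := uv _ _ (etrans (esym zR) Remx0).
have [ia ib] := uv _ _ (etrans (esym zI) Immx0).
by move: ab; rewrite !eq_complex /= ra rb ia ib eqxx.
Qed.

Local Close Scope sesquilinear_scope.

(** * Energy of a path grounded in its middle *)

(* Barta's inequality for one edge, q and q + d being the values of the
   positive supersolution at its two ends. *)
Lemma edge_energy_ge (R : realFieldType) (q d x y : R) : 0 < q -> 0 <= d ->
  y ^+ 2 * d / (q + d) <= x ^+ 2 * d / q + (x - y) ^+ 2.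
Proof.
move=> q0 d0; have qd0 : 0 < q + d by rewrite ltr_wpDr.
rewrite -subr_ge0.
have -> : x ^+ 2 * d / q + (x - y) ^+ 2 - y ^+ 2 * d / (q + d) =
          (x * (q + d) - y * q) ^+ 2 / (q * (q + d)).
  by field; rewrite !gt_eqF.
by rewrite divr_ge0 ?sqr_ge0 // ltW ?mulr_gt0.
Qed.

(* Solution of q_i - q_(i-1) = 1 + (q_(i+1) - q_i) on the vertices 0, ..., m-1
   with no flow beyond m-1; c is the value forced at 0 by the grounded edge. *)
Definition half_path_pot (R : realFieldType) (c : R) (m i : nat) : R :=
  c + i%:R * (2 * m%:R - 1 - i%:R) / 2.

Lemma half_path_pot_gt0 (R : realFieldType) (c : R) m i :
  0 < c -> (i < m)%N -> 0 < half_path_pot c m i.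
Proof.
move=> c0 im; rewrite ltr_wpDr // divr_ge0 ?mulr_ge0 ?ler0n //.
have : (i.+1%:R : R) <= m%:R by rewrite ler_nat.
rewrite -natr1; have := ler0n R i; lra.
Qed.

Lemma half_path_pot_le (R : realFieldType) (c : R) m i :
  (i < m)%N -> half_path_pot c m i <= c + m%:R * (m%:R - 1) / 2.
Proof.
move=> im; rewrite lerD2l ler_pdivlMr // mulfVK ?pnatr_eq0 //.
have : (i.+1%:R : R) <= m%:R by rewrite ler_nat.
rewrite -natr1 => le1; rewrite -subr_ge0.
have -> : m%:R * (m%:R - 1) - i%:R * (2 * m%:R - 1 - i%:R) =
  (m%:R - i%:R - 1) * (m%:R - i%:R) :> R by ring.
apply: mulr_ge0; lra.
Qed.

(** [alpha] is the conductance of the edge from vertex 0 to the ground. It carries the whole flow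
    [m.+1], hence the potential [m.+1%:R / alpha] at 0. *)
Lemma half_path_energy_ge (R : realFieldType) (alpha : R) (m : nat) (z : nat -> R) : 0 < alpha ->
  \sum_(i < m.+1) z i ^+ 2 / half_path_pot (m.+1%:R / alpha) m.+1 i <=
  alpha * z 0%N ^+ 2 + \sum_(i < m) (z i - z i.+1) ^+ 2.
Proof.
move=> a0; set q := half_path_pot _ _.
have q0 : 0 < m.+1%:R / alpha by rewrite divr_gt0.
(* The extra term is the flow m - r that vertex [r] passes on; it equals the increment of the
   potential from [r] to [r.+1] and vanishes at [r = m]. *)
suff H r : (r <= m)%N -> \sum_(i < r.+1) z i ^+ 2 / q i + z r ^+ 2 * (m%:R - r%:R) / q r <=
    alpha * z 0%N ^+ 2 + \sum_(i < r) (z i - z i.+1) ^+ 2.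
  by have := H m (leqnn m); rewrite subrr mulr0 mul0r addr0.
elim: r => [_|r IH rm].
  rewrite big_ord_recr !big_ord0 /= /q /half_path_pot mul0r mul0r addr0 add0r subr0 addr0.
  rewrite le_eqVlt; apply/orP; left; apply/eqP; rewrite -natr1; field.
  by rewrite gt_eqF //= natr1 pnatr_eq0.
rewrite big_ord_recr [X in _ <= _ + X]big_ord_recr /= addrA.
have := IH (ltnW rm).
set s1 := \sum_(i < r.+1) _; set s2 := \sum_(i < r) _ => IHr.
have d0 : 0 <= m%:R - r%:R :> R by rewrite subr_ge0 ler_nat ltnW.
have := edge_energy_ge (z r) (z r.+1) (half_path_pot_gt0 q0 (leqW rm)) d0.
have -> : half_path_pot (m.+1%:R / alpha) m.+1 r + (m%:R - r%:R) = q r.+1.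
  rewrite /q /half_path_pot -!natr1; field; lra.
rewrite -/(q r) => le1.
have -> : s1 + z r.+1 ^+ 2 / q r.+1 + z r.+1 ^+ 2 * (m%:R - r.+1%:R) / q r.+1 =
    s1 + z r.+1 ^+ 2 * (m%:R - r%:R) / q r.+1.
  rewrite -natr1; ring.
lra.
Qed.

Lemma sum_ord_rev (V : nmodType) (k : nat) (F : nat -> V) :
  \sum_(i < k) F i = \sum_(i < k) F (k - i.+1)%N.
Proof. by rewrite (reindex_inj rev_ord_inj). Qed.

(* The middle edge contributes (2 y_k)^2 = 2 y_k^2 + 2 y_(k+1)^2: it acts as two
   grounded edges of conductance 2. *)
Lemma even_path_energy_ge (R : realFieldType) (k : nat) :
  exists2 q : nat -> R,
    (forall a, (a < k.+1 + k.+1)%N -> 0 < q a <= (k.+1 + k.+1)%:R ^+ 2 / 8) &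
    forall y : nat -> R, y k + y k.+1 = 0 ->
      \sum_(a < k.+1 + k.+1) y a ^+ 2 / q a <= \sum_(a < k.+1 + k) (y a - y a.+1) ^+ 2.
Proof.
pose Q : nat -> R := half_path_pot (k.+1%:R / 2) k.+1.
(* The maximum is (k+1)/2 + k(k+1)/2 = (k+1)^2/2, exactly l^2/8 for l = 2k+2. *)
have Qb i : (i < k.+1)%N -> 0 < Q i <= (k.+1 + k.+1)%:R ^+ 2 / 8.
  move=> ik; rewrite half_path_pot_gt0 ?divr_gt0 //=.
  apply: le_trans (half_path_pot_le _ ik) _; rewrite natrD; lra.
pose q a := if (a <= k)%N then Q (k - a)%N else Q (a - k.+1)%N.
exists q.
  move=> a ha; rewrite /q; case: leqP => ka; apply: Qb; lia.
move=> y y0.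
have L := @half_path_energy_ge R 2 k (fun i => y (k - i)%N) (ltr0Sn R 1).
have U := @half_path_energy_ge R 2 k (fun i => y (k.+1 + i)%N) (ltr0Sn R 1).
have -> : \sum_(a < k.+1 + k.+1) y a ^+ 2 / q a
   = \sum_(i < k.+1) y (k - i)%N ^+ 2 / Q i + \sum_(i < k.+1) y (k.+1 + i)%N ^+ 2 / Q i.
  rewrite big_split_ord /=; congr (_ + _); last first.
    by apply: eq_bigr => i _; rewrite /q ifF ?addKn //; lia.
  rewrite (sum_ord_rev k.+1 (fun a => y a ^+ 2 / q a)).
  apply: eq_bigr => i _; rewrite /q subSS leq_subr.
  by congr (_ / Q _); have := ltn_ord i; lia.
have -> : \sum_(a < k.+1 + k) (y a - y a.+1) ^+ 2 =
   (\sum_(i < k) (y (k - i)%N - y (k - i.+1)%N) ^+ 2) + (y k - y k.+1) ^+ 2 +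
   \sum_(i < k) (y (k.+1 + i)%N - y (k.+1 + i.+1)%N) ^+ 2.
  rewrite big_split_ord /= big_ord_recr /=; congr (_ + _ + _); last first.
    by apply: eq_bigr => i _; rewrite -addnS.
  rewrite (sum_ord_rev k (fun a => (y a - y a.+1) ^+ 2)); apply: eq_bigr => i _.
  by rewrite subnSK // -sqrrN opprB.
apply: le_trans (lerD L U) _; rewrite subn0 addn0.
have -> : y k.+1 = - y k by lra.
rewrite le_eqVlt; apply/orP; left; apply/eqP; ring.
Qed.

(** The middle vertex is itself the ground, so each half hangs on an edge of conductance 1. The
    maximum (k+1)(k+2)/2 is just below l^2/8 for l = 2k+3. *)
Lemma odd_path_energy_ge (R : realFieldType) (k : nat) :
  exists2 q : nat -> R,
    (forall a, (a < k.+1 + k.+2)%N -> 0 < q a <= (k.+1 + k.+2)%:R ^+ 2 / 8) &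
    forall y : nat -> R, y k.+1 = 0 ->
      \sum_(a < k.+1 + k.+2) y a ^+ 2 / q a <= \sum_(a < k.+1 + k.+1) (y a - y a.+1) ^+ 2.
Proof.
pose Q : nat -> R := half_path_pot (k.+1%:R / 1) k.+1.
have Qb i : (i < k.+1)%N -> 0 < Q i <= (k.+1 + k.+2)%:R ^+ 2 / 8.
  move=> ik; rewrite half_path_pot_gt0 ?divr_gt0 //=.
  apply: le_trans (half_path_pot_le _ ik) _; rewrite natrD -[k.+2%:R]natr1; lra.
(* At the middle [a = k.+1] truncated subtraction gives [Q 0]; any positive value within the bound
   would do, as [y] vanishes there. *)
pose q a := if (a <= k)%N then Q (k - a)%N else Q (a - k.+2)%N.
exists q.
  by move=> a ha; rewrite /q; case: leqP => ka; apply: Qb; lia.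
move=> y y0.
have L := @half_path_energy_ge R 1 k (fun i => y (k - i)%N) (@ltr01 R).
have U := @half_path_energy_ge R 1 k (fun i => y (k.+2 + i)%N) (@ltr01 R).
have -> : \sum_(a < k.+1 + k.+2) y a ^+ 2 / q a
   = \sum_(i < k.+1) y (k - i)%N ^+ 2 / Q i + \sum_(i < k.+1) y (k.+2 + i)%N ^+ 2 / Q i.
  rewrite big_split_ord /=; congr (_ + _); last first.
    rewrite big_ord_recl /= addn0 y0 expr0n mul0r add0r.
    by apply: eq_bigr => i _; rewrite /q ifF -?addSnnS ?addKn //; lia.
  rewrite (sum_ord_rev k.+1 (fun a => y a ^+ 2 / q a)).
  apply: eq_bigr => i _; rewrite /q subSS leq_subr.
  by congr (_ / Q _); have := ltn_ord i; lia.
have -> : \sum_(a < k.+1 + k.+1) (y a - y a.+1) ^+ 2 =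
   (\sum_(i < k) (y (k - i)%N - y (k - i.+1)%N) ^+ 2) + y k ^+ 2 + (y k.+2 ^+ 2 +
   \sum_(i < k) (y (k.+2 + i)%N - y (k.+2 + i.+1)%N) ^+ 2).
  rewrite big_split_ord /= big_ord_recr [X in _ + X]big_ord_recl /= addn0 y0.
  rewrite subr0 sub0r sqrrN; congr (_ + _ + (_ + _)); last first.
    by apply: eq_bigr => i _; rewrite /bump /= !(addSn, addnS, add0n).
  rewrite (sum_ord_rev k (fun a => (y a - y a.+1) ^+ 2)); apply: eq_bigr => i _.
  by rewrite subnSK // -sqrrN opprB.
apply: le_trans (lerD L U) _; rewrite subn0 addn0 !mul1r; lra.
Qed.

(** One condition serves both parities: for even [l] the indices are the two middle vertices, for
    odd [l] they coincide and [y] vanishes in the middle. *)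
Lemma path_energy_ge (R : realFieldType) (l : nat) : (2 <= l)%N ->
  exists2 q : nat -> R,
    (forall a, (a < l)%N -> 0 < q a <= l%:R ^+ 2 / 8) &
    forall y : nat -> R, y l.-1./2 + y l./2 = 0 ->
      \sum_(a < l) y a ^+ 2 / q a <= \sum_(a < l.-1) (y a - y a.+1) ^+ 2.
Proof.
move=> l2.
have [lo|le] := boolP (odd l).
  have [k ->] : exists k, l = (k.+1 + k.+2)%N by exists l./2.-1; lia.
  have [q qb qE] := odd_path_energy_ge R k; apply: (ex_intro2 _ _ q qb) => y.
  have -> : (k.+1 + k.+2).-1./2 = k.+1 by lia.
  have -> : (k.+1 + k.+2)./2 = k.+1 by lia.
  have -> : (k.+1 + k.+2).-1 = (k.+1 + k.+1)%N by lia.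
  by move=> y0; apply: qE; lra.
have [k ->] : exists k, l = (k.+1 + k.+1)%N by exists l./2.-1; lia.
have [q qb qE] := even_path_energy_ge R k; apply: (ex_intro2 _ _ q qb) => y.
have -> : (k.+1 + k.+1).-1./2 = k by lia.
have -> : (k.+1 + k.+1)./2 = k.+1 by lia.
have -> : (k.+1 + k.+1).-1 = (k.+1 + k)%N by lia.
exact: qE.
Qed.

(** * Energy of a full binary tree *)

Lemma sum_ord_double (V : nmodType) (m : nat) (F : nat -> V) :
  \sum_(b < m.*2) F b = \sum_(k < m) (F k.*2 + F k.*2.+1).
Proof.
elim: m => [|m IH]; first by rewrite !big_ord0.
by rewrite doubleS !big_ord_recr /= IH addrA.
Qed.

Definition heap_depth (b : nat) : nat := trunc_log 2 b.+1.

Lemma heap_depth_child k :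
  heap_depth k.*2.+1 = (heap_depth k).+1 /\ heap_depth k.*2.+2 = (heap_depth k).+1.
Proof.
by split; rewrite /heap_depth trunc_log2S //; congr (trunc_log 2 _).+1; lia.
Qed.

Lemma heap_depth_lt h b : (b.+1 < 2 ^ h)%N -> (heap_depth b < h)%N.
Proof.
move=> bh; rewrite -(ltn_exp2l _ _ (isT : 1 < 2)%N).
by apply: leq_ltn_trans bh; apply: trunc_logP.
Qed.

Lemma heap_depth_leaf h b :
  (2 ^ h <= b.+1 -> b.+1 < 2 ^ h.+1 -> heap_depth b = h)%N.
Proof.
move=> lo hi; apply/eqP; rewrite eqn_leq -ltnS heap_depth_lt //=.
by apply: trunc_log_max.
Qed.

(** In the tree on 2^h - 1 vertices, the number of vertices at or below [b], which is the flow
    carried by the edge above [b]. *)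
Definition subtree_size (R : nzRingType) (h b : nat) : R :=
  (2 ^ (h - heap_depth b))%:R - 1.

(* Sum of the sizes 2^(h-i) - 1, 0 < i <= depth b, of the subtrees hanging below
   the edges of the path from the root to b. *)
Definition tree_pot (R : nzRingType) (h b : nat) : R :=
  (2 ^ h)%:R - (2 ^ (h - heap_depth b))%:R - (heap_depth b)%:R.

Lemma subtree_size_child (R : comNzRingType) h k c : (k.+1 < 2 ^ h)%N -> c = k.*2.+1 \/ c = k.*2.+2 ->
  subtree_size R h.+1 k = 2 * subtree_size R h.+1 c + 1 /\
  tree_pot R h.+1 c = tree_pot R h.+1 k + subtree_size R h.+1 c.
Proof.
move=> kh cE; have dk := heap_depth_lt kh.
have dc : heap_depth c = (heap_depth k).+1.
  by have [d1 d2] := heap_depth_child k; case: cE => ->.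
rewrite /subtree_size /tree_pot dc subSS subSn ?(ltnW dk) // expnS natrM -natr1.
split; ring.
Qed.

Lemma subtree_size_ge0 (R : realDomainType) h b : 0 <= subtree_size R h b.
Proof. by rewrite subr_ge0 ler1n expn_gt0. Qed.

Lemma tree_pot_ge0 (R : realFieldType) h b : (b.+1 < 2 ^ h)%N -> 0 <= tree_pot R h b.
Proof.
move=> bh; have d := heap_depth_lt bh; rewrite /tree_pot.
rewrite -addrA -opprD subr_ge0 -natrD ler_nat.
rewrite -{2}(subnK (ltnW d)) expnD.
set e := (h - _)%N; set dd := heap_depth b in d e *.
have : (dd < 2 ^ dd)%N by apply: ltn_expl.
have : (0 < 2 ^ e)%N by rewrite expn_gt0.
nia.
Qed.

Lemma tree_pot_le (R : realFieldType) h b : (b.+1 < 2 ^ h)%N ->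
  tree_pot R h b <= (2 ^ h)%:R - 1 - h%:R.
Proof.
move=> bh; have d := heap_depth_lt bh; rewrite /tree_pot.
have : (h - heap_depth b < 2 ^ (h - heap_depth b))%N by apply: ltn_expl.
rewrite -(ler_nat R) -natr1 natrB ?(ltnW d) //; lra.
Qed.

(** Barta's inequality on every tree edge, with potential [gam] at the root. At any other vertex
    inflow exceeds outflow by 1; the root only pays out, to the 2^(h+1) - 2 vertices below it. *)
Lemma tree_energy_ge (R : realFieldType) (h : nat) (gam M : R) (y : nat -> R) :
  0 < gam -> gam + (2 ^ h.+1)%:R - 1 - h.+1%:R <= M ->
  \sum_(b < (2 ^ h - 1).*2) y b.+1 ^+ 2 / M - y 0%N ^+ 2 * ((2 ^ h.+1)%:R - 2) / gam <=
  \sum_(k < 2 ^ h - 1) ((y k - y k.*2.+1) ^+ 2 + (y k - y k.*2.+2) ^+ 2).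
Proof.
move=> g0 gM; set m := (2 ^ h - 1)%N.
have mE : (m.+1 = 2 ^ h)%N by rewrite /m subn1 prednK ?expn_gt0.
pose g b := gam + tree_pot R h.+1 b; pose S := subtree_size R h.+1.
have nE : (2 ^ h.+1 = (m.*2.+2))%N by rewrite expnS -mE; lia.
have gpos b : (b <= m.*2)%N -> 0 < g b.
  by move=> bm; rewrite ltr_wpDr // tree_pot_ge0 // nE; lia.
have gle b : (b <= m.*2)%N -> g b <= M.
  move=> bm; apply: le_trans gM; rewrite -!addrA lerD2l addrA.
  by apply: tree_pot_le; rewrite nE; lia.
have Sleaf b : (m <= b)%N -> (b <= m.*2)%N -> S b = 1.
  move=> mb bm; rewrite /S /subtree_size (@heap_depth_leaf h b).
  - by rewrite subSn // subnn expn1; ring.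
  - by rewrite -mE.
  - by rewrite nE; lia.
have edge k c : (k < m)%N -> c = k.*2.+1 \/ c = k.*2.+2 ->
    y c ^+ 2 * S c / g c - y k ^+ 2 * ((S k - 1) / 2) / g k <= (y k - y c) ^+ 2.
  move=> km cE; have kh : (k.+1 < 2 ^ h)%N by rewrite -mE.
  have [Sk gc] := subtree_size_child R kh cE.
  have -> : (S k - 1) / 2 = S c by rewrite /S Sk; field.
  have gk : 0 < g k by apply: gpos; lia.
  have := edge_energy_ge (y k) (y c) gk (subtree_size_ge0 R h.+1 c).
  have -> : g c = g k + S c by rewrite /g gc addrA.
  by rewrite lerBlDr [X in _ <= X]addrC.
apply: (@le_trans _ _ (\sum_(k < m) (y k.*2.+1 ^+ 2 * S k.*2.+1 / g k.*2.+1 + y k.*2.+2 ^+ 2 * S k.*2.+2 / g k.*2.+2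
    - y k ^+ 2 * (S k - 1) / g k))); last first.
  apply: ler_sum => k _.
  have := edge k _ (ltn_ord k) (or_introl erefl).
  have := edge k _ (ltn_ord k) (or_intror erefl).
  set u := _ / g k; set v := _ / g k.
  have -> : v = 2 * u by rewrite /u /v; field; apply: lt0r_neq0; apply: gpos; have := ltn_ord k; lia.
  lra.
rewrite sumrB -(sum_ord_double m (fun b => y b.+1 ^+ 2 * S b.+1 / g b.+1)).
(* Leaves have [S = 1], so the sum over inner vertices extends to all vertices; then the root is
   split off. *)
have -> : \sum_(k < m) y k ^+ 2 * (S k - 1) / g k =
   y 0%N ^+ 2 * ((2 ^ h.+1)%:R - 2) / gam + \sum_(b < m.*2) y b.+1 ^+ 2 * (S b.+1 - 1) / g b.+1.
  transitivity (\sum_(k < m.*2.+1) y k ^+ 2 * (S k - 1) / g k).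
    have -> : m.*2.+1 = (m + m.+1)%N by lia.
    rewrite big_split_ord /= [X in _ = _ + X]big1 ?addr0 // => i _.
    by rewrite Sleaf ?subrr ?mulr0 ?mul0r //; have := ltn_ord i; lia.
  rewrite big_ord_recl /=; congr (_ + _).
  have d0 : heap_depth 0 = 0%N by rewrite /heap_depth trunc_log1.
  rewrite /g /S /subtree_size /tree_pot d0 subn0 subrr sub0r oppr0 addr0.
  by congr (_ * _ / _); ring.
rewrite [X in _ <= _ - X]addrC [X in _ <= _ + X]opprD addrA -sumrB lerD2r.
apply: ler_sum => i _; have ib : (i.+1 <= m.*2)%N by [].
rewrite -mulrBl -mulrBr opprB addrCA subrr addr0 mulr1 ler_wpM2l ?sqr_ge0 //.
by rewrite lef_pV2 ?posrE ?gpos ?gle // (lt_le_trans (gpos _ ib) (gle _ ib)).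
Qed.

(** * The graph of trees joined along their roots *)

Lemma laplacian_sym (R : nzRingType) N (adj : rel 'I_N) :
  symmetric adj -> (laplacian R adj)^T = laplacian R adj.
Proof.
move=> adjC; apply/matrixP=> i j; rewrite !mxE eq_sym adjC.
by case: eqVneq => [->|].
Qed.

Lemma quadf_laplacian (R : comNzRingType) N (adj : rel 'I_N) (v : 'rV[R]_N) :
  irreflexive adj ->
  quadf (laplacian R adj) v = \sum_i \sum_j (adj i j)%:R * (v 0 i ^+ 2 - v 0 i * v 0 j).
Proof.
move=> adjI; rewrite quadfE; apply: eq_bigr => i _.
transitivity (v 0 i ^+ 2 * (\sum_j (adj i j)%:R) - \sum_j (adj i j)%:R * (v 0 i * v 0 j)); last first.
  rewrite mulr_sumr -sumrB; apply: eq_bigr => j _; ring.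
have -> : \sum_j (adj i j)%:R = #|[set k | adj i k]|%:R :> R.
  rewrite -sum1_card natr_sum [RHS]big_mkcond /=; apply: eq_bigr => j _.
  by rewrite inE; case: (adj i j).
rewrite (bigD1 i) //= [X in _ = _ - X](bigD1 i) //= adjI mul0r add0r !mxE eqxx -sumrN.
congr (_ + _); first by ring.
apply: eq_bigr => j ij; rewrite !mxE eq_sym (negPf ij); ring.
Qed.

(** The equation in [nat] makes [dir] orient each edge exactly once, hence no factor 1/2. *)
Lemma quadf_laplacian_oriented (R : comNzRingType) N (adj dir : rel 'I_N) (v : 'rV[R]_N) :
  irreflexive adj -> (forall i j, adj i j = (dir i j + dir j i)%N :> nat) ->
  quadf (laplacian R adj) v = \sum_i \sum_j (dir i j)%:R * (v 0 i - v 0 j) ^+ 2.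
Proof.
move=> adjI adjE; rewrite quadf_laplacian //.
transitivity (\sum_i \sum_j (dir i j)%:R * (v 0 i ^+ 2 - v 0 i * v 0 j) +
              \sum_i \sum_j (dir i j)%:R * (v 0 j ^+ 2 - v 0 i * v 0 j)).
  rewrite [X in _ + X]exchange_big -big_split /=; apply: eq_bigr => i _.
  rewrite -big_split /=; apply: eq_bigr => j _.
  rewrite adjE natrD; ring.
rewrite -big_split /=; apply: eq_bigr => i _.
rewrite -big_split /=; apply: eq_bigr => j _; ring.
Qed.

Lemma sum_ord_divmod (V : nmodType) (l n : nat) (F : nat -> nat -> V) : (0 < n)%N ->
  \sum_(i < l * n) F (i %/ n)%N (i %% n)%N = \sum_(a < l) \sum_(b < n) F a b.
Proof.
move=> n0; elim: l => [|l IH]; first by rewrite !big_ord0.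
rewrite big_ord_recr /= -IH mulSnr big_split_ord /=; congr (_ + _).
apply: eq_bigr => b _.
by rewrite divnMDl // divn_small // addn0 modnMDl modn_small.
Qed.

Lemma sum_ord_pick (R : pzSemiRingType) (n k : nat) (F : nat -> R) :
  \sum_(d < n) (d == k :> nat)%:R * F d = if (k < n)%N then F k else 0.
Proof.
case: ltnP => kn.
  rewrite (bigD1 (Ordinal kn)) //= eqxx mul1r big1 ?addr0 // => d.
  by rewrite -val_eqE /= => /negPf ->; rewrite mul0r.
rewrite big1 // => d _; case: eqP => [dk|_]; last by rewrite mul0r.
by have := ltn_ord d; rewrite dk ltnNge kn.
Qed.

Lemma sum_ord_ltn (V : nmodType) (n m : nat) (F : nat -> V) : (m <= n)%N ->
  \sum_(b < n) (if (b < m)%N then F b else 0) = \sum_(b < m) F b.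
Proof. by move=> mn; rewrite [RHS](big_ord_widen _ _ mn) [RHS]big_mkcond. Qed.

(* Edges directed away from the root of each copy and along the path of roots. *)
Definition Tnl_dir (n l : nat) (i j : 'I_(l * n)) : bool :=
  let a := (i %/ n)%N in let b := (i %% n)%N in
  let c := (j %/ n)%N in let d := (j %% n)%N in
  ((c == a) && ((d == b.*2.+1) || (d == b.*2.+2))) || [&& b == 0, d == 0 & c == a.+1]%N.

Lemma Tnl_adj_irr n l : irreflexive (Tnl_adj n l).
Proof.
move=> i; rewrite /Tnl_adj /bt_adj /=.
move: (i %/ n)%N (i %% n)%N => a b.
by have [?|?] := eqVneq b b.*2.+1; have [?|?] := eqVneq b b.*2.+2; have [?|?] := eqVneq a a.+1; rewrite ?andbF //=; lia.
Qed.

Lemma Tnl_adj_dir n l (i j : 'I_(l * n)) :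
  Tnl_adj n l i j = (Tnl_dir i j + Tnl_dir j i)%N :> nat.
Proof.
rewrite /Tnl_adj /Tnl_dir /bt_adj /=.
move: (i %/ n)%N (i %% n)%N (j %/ n)%N (j %% n)%N => a b c d.
rewrite (eq_sym c a).
have [?|?] := eqVneq a c; have [?|?] := eqVneq d b.*2.+1; have [?|?] := eqVneq d b.*2.+2;
  have [?|?] := eqVneq b d.*2.+1; have [?|?] := eqVneq b d.*2.+2;
  have [?|?] := eqVneq b 0%N; have [?|?] := eqVneq d 0%N;
  have [?|?] := eqVneq c a.+1; have [?|?] := eqVneq a c.+1; rewrite //=; lia.
Qed.

Lemma Tnl_adj_sym n l : symmetric (Tnl_adj n l).
Proof.
move=> i j; have := Tnl_adj_dir i j; rewrite addnC -Tnl_adj_dir.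
by do 2 case: Tnl_adj.
Qed.

Definition copies_row (R : Type) (n l : nat) (x : nat -> nat -> R) : 'rV[R]_(l * n) :=
  \row_i x (i %/ n)%N (i %% n)%N.

Lemma copies_rowP (R : nzRingType) n l (v : 'rV[R]_(l * n)) :
  exists x, v = copies_row n l x.
Proof.
exists (fun a b => if insub (a * n + b)%N is Some i then v 0 i else 0).
by apply/rowP => i; rewrite mxE -divn_eq valK.
Qed.

(** A copy has [m.*2.+1] vertices, and the indices below [m] are exactly those with children. *)
Definition copies_energy (R : pzRingType) (m l : nat) (x : nat -> nat -> R) : R :=
  \sum_(a < l) \sum_(k < m) ((x a k - x a k.*2.+1) ^+ 2 + (x a k - x a k.*2.+2) ^+ 2) +
  \sum_(a < l.-1) (x a 0%N - x a.+1 0%N) ^+ 2.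

Lemma quadf_Tnl (R : comNzRingType) (m l : nat) (x : nat -> nat -> R) :
  quadf (laplacian R (Tnl_adj m.*2.+1 l)) (copies_row m.*2.+1 l x) = copies_energy m l x.
Proof.
rewrite (quadf_laplacian_oriented _ (@Tnl_adj_irr _ _) (@Tnl_adj_dir _ _)).
set n := m.*2.+1.
pose D a b c d : R := (x a b - x c d) ^+ 2.
pose dir a b c d : bool :=
  ((c == a) && ((d == b.*2.+1) || (d == b.*2.+2))) || [&& b == 0, d == 0 & c == a.+1]%N.
transitivity (\sum_(a < l) \sum_(b < n) \sum_(c < l) \sum_(d < n) (dir a b c d)%:R * D a b c d).
  rewrite -(sum_ord_divmod l (fun a b => \sum_(c < l) \sum_(d < n) (dir a b c d)%:R * D a b c d)) //.
  apply: eq_bigr => i _.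
  rewrite -(sum_ord_divmod l (fun c d => (dir (i %/ n)%N (i %% n)%N c d)%:R * D (i %/ n)%N (i %% n)%N c d)) //.
  by apply: eq_bigr => j _; rewrite !mxE.
(* Energy of the edges leaving vertex [b] of copy [a]: to its children, and from a root to the next
   root. *)
have E (a : 'I_l) (b : 'I_n) : \sum_(c < l) \sum_(d < n) (dir a b c d)%:R * D a b c d =
    (if (b < m)%N then D a b a b.*2.+1 + D a b a b.*2.+2 else 0) +
    (b == 0 :> nat)%:R * (if (a < l.-1)%N then D a 0%N a.+1 0%N else 0).
  transitivity (\sum_(c < l) (c == a :> nat)%:R *
       (\sum_(d < n) (d == b.*2.+1 :> nat)%:R * D a b c d + \sum_(d < n) (d == b.*2.+2 :> nat)%:R * D a b c d) +
     \sum_(c < l) (c == a.+1 :> nat)%:R * ((b == 0 :> nat)%:R * \sum_(d < n) (d == 0 :> nat)%:R * D a b c d)).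
    rewrite -big_split /=; apply: eq_bigr => c _.
    rewrite -big_split /= !mulr_sumr -big_split /=; apply: eq_bigr => d _.
    have -> : (dir a b c d)%:R = (c == a :> nat)%:R * ((d == b.*2.+1 :> nat)%:R + (d == b.*2.+2 :> nat)%:R)
         + (b == 0 :> nat)%:R * (d == 0 :> nat)%:R * (c == a.+1 :> nat)%:R :> R.
      rewrite -natrD -!natrM -natrD; congr (_%:R); rewrite /dir.
      by case: (nat_of_ord d == 0)%N; lia.
    ring.
  under eq_bigr do rewrite !sum_ord_pick.
  rewrite (sum_ord_pick l a (fun c => (if (b.*2.+1 < n)%N then D a b c b.*2.+1 else 0) +
                                      (if (b.*2.+2 < n)%N then D a b c b.*2.+2 else 0))) ltn_ord.
  under [X in _ + X]eq_bigr do rewrite sum_ord_pick.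
  rewrite (sum_ord_pick l a.+1 (fun c => (b == 0 :> nat)%:R * D a b c 0%N)).
  congr (_ + _).
    have -> : (b.*2.+1 < n)%N = (b < m)%N by rewrite /n; lia.
    have -> : (b.*2.+2 < n)%N = (b < m)%N by rewrite /n; lia.
    by case: ifP; rewrite ?addr0.
  have -> : (a.+1 < l)%N = (a < l.-1)%N by lia.
  by case: ifP => _; rewrite ?mulr0 //; case: (nat_of_ord b =P 0%N) => [->|]; rewrite ?mul0r.
rewrite /copies_energy.
under eq_bigr => a _ do under eq_bigr => b _ do rewrite E.
rewrite -(@sum_ord_ltn _ _ _ (fun a => D a 0%N a.+1 0%N) (leq_pred l)) -big_split /=; apply: eq_bigr => a _.
rewrite big_split /=; congr (_ + _).
  by rewrite (@sum_ord_ltn _ n m (fun b => D a b a b.*2.+1 + D a b a b.*2.+2)) // /n; lia.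
by rewrite (sum_ord_pick n 0%N (fun=> _)).
Qed.

Lemma quadf_one_copies (R : comNzRingType) (n l : nat) (x : nat -> nat -> R) : (0 < n)%N ->
  quadf 1%:M (copies_row n l x) = \sum_(a < l) \sum_(b < n) x a b ^+ 2.
Proof.
move=> n0; rewrite /quadf mulmx1 mxE -(sum_ord_divmod l (fun a b => x a b ^+ 2)) //.
by apply: eq_bigr => i _; rewrite !mxE.
Qed.

(** Each root receives n = 2^(h+1) - 1 units of flow, one for itself and n - 1 for its tree. So the
    path potential [q] is scaled by n and continued into each copy by the tree potential. *)
Lemma copies_energy_ge (R : realType) (h l : nat) (M : R) (x : nat -> nat -> R) :
  (2 <= l)%N ->
  l%:R ^+ 2 * ((2 ^ h.+1)%:R - 1) / 8 + (2 ^ h.+1)%:R - 1 - h.+1%:R <= M ->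
  \sum_(a < l) \sum_(b < (2 ^ h - 1).*2.+1) x a b = 0 ->
  (\sum_(a < l) \sum_(b < (2 ^ h - 1).*2.+1) x a b ^+ 2) / M <= copies_energy (2 ^ h - 1) l x.
Proof.
move=> l2 lM x0; set m := (2 ^ h - 1)%N.
have mE : (2 ^ h = m.+1)%N by rewrite /m subn1 prednK ?expn_gt0.
have nE : (2 ^ h.+1 = (m.*2.+2))%N by rewrite expnS mE; lia.
have [q qb qE] := path_energy_ge R l2.
(* [t] is the mean over the two middle roots, so that [y] meets the condition of
   [path_energy_ge]. *)
pose t := (x l.-1./2 0%N + x l./2 0%N) / 2; pose y a b := x a b - t.
have -> : copies_energy m l x = copies_energy m l y.
  congr (_ + _); last by apply: eq_bigr => a _; rewrite /y; ring.
  by apply: eq_bigr => a _; apply: eq_bigr => k _; rewrite /y; ring.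
have n_gt0 : 0 < (m.*2.+1)%:R :> R by rewrite ltr0n.
have nR : (2 ^ h.+1)%:R = (m.*2.+1)%:R + 1 :> R by rewrite nE natr1.
have hn : h.+1%:R <= (m.*2.+1)%:R :> R by rewrite ler_nat -ltnS -nE ltn_expl.
move: lM; rewrite nR => lM.
have M_gt0 : 0 < M.
  apply: lt_le_trans lM; have : 0 < l%:R ^+ 2 * m.*2.+1%:R :> R.
    by rewrite mulr_gt0 ?exprn_gt0 // ltr0n; lia.
  lra.
(* The cross term vanishes because [x] sums to 0. *)
have le_xy : \sum_(a < l) \sum_(b < m.*2.+1) x a b ^+ 2 <= \sum_(a < l) \sum_(b < m.*2.+1) y a b ^+ 2.
  have -> : \sum_(a < l) \sum_(b < m.*2.+1) y a b ^+ 2 =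
    \sum_(a < l) \sum_(b < m.*2.+1) x a b ^+ 2 - 2 * t * \sum_(a < l) \sum_(b < m.*2.+1) x a b
     + \sum_(a < l) \sum_(b < m.*2.+1) t ^+ 2.
    rewrite mulr_sumr -sumrB -big_split; apply: eq_bigr => a _.
    rewrite mulr_sumr -sumrB -big_split; apply: eq_bigr => b _; rewrite /y /=; ring.
  rewrite x0 mulr0 subr0 lerDl; apply: sumr_ge0 => a _; apply: sumr_ge0 => b _; exact: sqr_ge0.
apply: (le_trans (ler_wpM2r _ le_xy)); first by rewrite invr_ge0 ltW.
have path_y := qE (fun a => y a 0%N) _.
have {path_y} path_y : \sum_(a < l) y a 0%N ^+ 2 / q a <= \sum_(a < l.-1) (y a 0%N - y a.+1 0%N) ^+ 2.
  by apply: path_y; rewrite /y /t; lra.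
apply: le_trans (lerD (lexx _) path_y); rewrite -big_split mulr_suml /=.
apply: ler_sum => a _.
have /andP[q_gt0 q_le] := qb a (ltn_ord a).
have g_gt0 : 0 < m.*2.+1%:R * q a by rewrite mulr_gt0.
have g_le : m.*2.+1%:R * q a <= l%:R ^+ 2 * m.*2.+1%:R / 8.
  by rewrite [X in _ <= X]mulrAC mulrC ler_wpM2r // ltW.
have gM : m.*2.+1%:R * q a + (2 ^ h.+1)%:R - 1 - h.+1%:R <= M by rewrite nR; lra.
have := tree_energy_ge (y a) g_gt0 gM; rewrite -/m.
set T := \sum_(k < m) _ => tree_y.
rewrite big_ord_recl /= mulrDl mulr_suml.
have root : y a 0%N ^+ 2 / M <= y a 0%N ^+ 2 / (m.*2.+1%:R * q a).
  rewrite ler_wpM2l ?sqr_ge0 // lef_pV2 ?posrE //.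
  by move: gM; rewrite nR; lra.
(* Of the path's root term, the share n - 1 pays the tree's deficit and the share 1 covers the
   root's own [y a 0%N ^+ 2 / M]. *)
have qaE : y a 0%N ^+ 2 / q a = y a 0%N ^+ 2 * ((2 ^ h.+1)%:R - 2) / (m.*2.+1%:R * q a) +
    y a 0%N ^+ 2 / (m.*2.+1%:R * q a).
  by rewrite nR; field; rewrite addrC natr1 !gt_eqF.
rewrite qaE; set U := \sum_(i < m.*2) _.
have {}tree_y : U - y a 0%N ^+ 2 * ((2 ^ h.+1)%:R - 2) / (m.*2.+1%:R * q a) <= T by [].
by rewrite [X in X <= _]addrC addrA lerD ?root // -lerBlDr.
Qed.

(** * Numerical comparison and the two bounds *)

Lemma log2_ge (R : realType) (n k : nat) : (2 ^ k <= n)%N -> k%:R <= log2 (n%:R : R).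
Proof.
move=> kn; have ln2 : 0 < ln 2 :> R by rewrite ln_gt0 // ltr1n.
rewrite /log2 ler_pdivlMr // mulr_natl -lnXn ?ltr0n //.
have n0 : (0 < n)%N by apply: leq_trans kn; rewrite expn_gt0.
by rewrite ler_ln ?posrE ?exprn_gt0 ?ltr0n // -natrX ler_nat.
Qed.

Lemma copies_bound_le (R : realType) (h l : nat) : (2 <= l)%N ->
  2 * (l%:R ^+ 2 * (2 ^ h.+2 - 1)%:R / 8 + (2 ^ h.+2 - 1)%:R - h.+2%:R) <=
  ((2 ^ h.+2 - 1)%:R * l%:R - 1) * (l%:R * log2 ((2 ^ h.+2 - 2)%:R : R) - 1).
Proof.
move=> l2.
have l2R : 2 <= l%:R :> R by rewrite ler_nat.
(* For n = 3 the logarithm is 1, and l = 2 gives equality. For n >= 7 the logarithm is at least 2,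
   which leaves room to drop the height term. *)
case: h => [|h]; set n : R := (2 ^ _ - 1)%:R.
  have -> : n = 3 by [].
  have -> : (2 ^ 2 - 2 = 2)%N by [].
  have : 1 <= log2 (2%:R : R) by apply: (@log2_ge R 2 1).
  move=> log1.
  have : (3 * l%:R - 1) * (l%:R - 1) <= (3 * l%:R - 1) * (l%:R * log2 2 - 1) :> R.
    apply: ler_wpM2l; first lra.
    rewrite lerD2r ler_peMr //; lra.
  apply: le_trans; nra.
have n7 : 7 <= n.
  rewrite /n ler_nat; have : (0 < 2 ^ h)%N by rewrite expn_gt0.
  by rewrite !expnS; lia.
have log2_ : 2 <= log2 ((2 ^ h.+3 - 2)%:R : R).
  apply: (@log2_ge R _ 2); have : (0 < 2 ^ h)%N by rewrite expn_gt0.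
  by rewrite !expnS; lia.
have nl : 0 <= n * l%:R - 1 by nra.
apply: (@le_trans _ _ ((n * l%:R - 1) * (l%:R * 2 - 1))); last first.
  apply: ler_wpM2l => //; rewrite lerD2r ler_wpM2l //; lra.
have h0 : 0 <= h.+3%:R :> R by [].
have : 0 <= (l%:R - 2) * n by rewrite mulr_ge0; lra.
have : 0 <= (l%:R - 2) * (l%:R - 2) * n by rewrite !mulr_ge0; lra.
have : 0 <= (l%:R - 2) * (n - 7) by rewrite mulr_ge0; lra.
nra.
Qed.

(* n = 2^h - 1, lambda_2 = s`_1 for the sorted spectrum s of the Laplacian. *)
Theorem theorem6p3 (R : realType) (h l : nat) (s : seq R) :
  (2 <= h)%N -> (2 <= l)%N ->
  sorted_spectrum (laplacian R (Tnl_adj (2 ^ h - 1)%N l)) s ->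
  let n := (2 ^ h - 1)%N in
  2 / (((n * l)%:R - 1) * (l%:R * log2 ((n - 1)%:R : R) - 1)) <= s`_1 /\
  s`_1 <= l%:R / (n - 1)%:R.
Proof.
case: h => [//|[//|h]] _ l2; set m := (2 ^ h.+1 - 1)%N.
have h0 : (0 < 2 ^ h)%N by rewrite expn_gt0.
have m0 : (0 < m)%N.
  by rewrite /m expnS; lia.
have nE : (2 ^ h.+2 - 1 = m.*2.+1)%N.
  by rewrite /m !expnS; lia.
rewrite nE => spec n.
have N1 : (1 < l * m.*2.+1)%N by nia.
have Lsym := laplacian_sym R (@Tnl_adj_sym m.*2.+1 l).
split.
  (* After the case split the trees have [h.+2] levels; [M] bounds the potential on the whole
     graph. *)
  pose M : R := l%:R ^+ 2 * n%:R / 8 + n%:R - h.+2%:R.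
  have M0 : 0 < M.
    have hn : h.+2%:R <= n%:R :> R by rewrite ler_nat /n -nE -ltnS subn1 prednK ?expn_gt0 // ltn_expl.
    have : 0 < l%:R ^+ 2 * n%:R :> R by rewrite mulr_gt0 ?exprn_gt0 // ltr0n; lia.
    rewrite /M; lra.
  apply: (@le_trans _ _ M^-1).
    have := @copies_bound_le R h l l2; rewrite nE -/n -/M.
    have -> : (2 ^ h.+2 - 2 = n - 1)%N by rewrite /n -nE; lia.
    rewrite natrM; set P := ((_ - 1) * _) => MP.
    have P0 : 0 < P by lra.
    by rewrite ler_pdivrMr // mulrC ler_pdivlMr.
  apply: (second_eigenvalue_ge (w := const_mx 1) N1 Lsym spec) => v.
  have [x ->] := copies_rowP v.
  rewrite quadf_Tnl quadf_one_copies // mulrC => /matrixP/(_ 0 0).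
  rewrite !mxE => vs; apply: copies_energy_ge => //.
    have -> : (2 ^ h.+2)%:R = n%:R + 1 :> R.
      by rewrite natr1 /n -nE subn1 prednK ?expn_gt0.
    rewrite /M; lra.
  rewrite -/m -(sum_ord_divmod l x) // -[RHS]vs; apply: eq_bigr => i _.
  by rewrite !mxE mulr1.
(* Indicator of the first copy: it changes only across the edge joining the first two roots. *)
pose x0 (a b : nat) : R := (a == 0)%:R.
have nR : (n - 1)%:R = n%:R - 1 :> R by rewrite natrB.
have n3 : 3 <= n%:R :> R by rewrite ler_nat /n; lia.
have l2R : 2 <= l%:R :> R by rewrite ler_nat.
have combE (a b : R) : a *: copies_row n l (fun _ _ => 1) + b *: copies_row n l x0 =
    copies_row n l (fun c _ => a + b * (c == 0)%:R).
  by apply/rowP => i; rewrite !mxE mulr1.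
have sumE (F : nat -> R) : \sum_(c < l) F c = F 0%N + \sum_(c < l.-1) F c.+1.
  by case: (l) l2 => // k _; rewrite big_ord_recl.
have normE (a b : R) : quadf 1%:M (a *: copies_row n l (fun _ _ => 1) + b *: copies_row n l x0) =
    n%:R * ((a + b) ^+ 2 + (l%:R - 1) * a ^+ 2).
  rewrite combE quadf_one_copies //.
  rewrite (sumE (fun c => \sum_(i < n) (a + b * (c == 0)%:R) ^+ 2)) /=.
  rewrite mulr0 mulr1 addr0 !sumr_const !card_ord.
  have -> : l%:R - 1 = l.-1%:R :> R by rewrite -subn1 natrB //; lia.
  rewrite -[(a + b) ^+ 2 *+ _]mulr_natl -[_ *+ l.-1]mulr_natl -[a ^+ 2 *+ _]mulr_natl; ring.
apply: (second_eigenvalue_le (u := copies_row n l (fun _ _ => 1)) (v := copies_row n l x0) N1 Lsym spec).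
  move=> a b ab0; have := normE a b; rewrite ab0 /quadf !mul0mx mxE => /esym /eqP.
  rewrite mulf_eq0 gt_eqF /=; last lra.
  have l1 : 0 < l%:R - 1 :> R by lra.
  rewrite paddr_eq0 ?sqr_ge0 ?(mulr_ge0 (ltW l1) (sqr_ge0 a)) //.
  rewrite [X in _ && X]mulf_eq0 !sqrf_eq0 (gt_eqF l1) /=.
  move=> /andP[/eqP ab /eqP a0]; split=> //; lra.
move=> a b; rewrite normE combE quadf_Tnl /copies_energy big1 ?add0r; last first.
  by move=> c _; rewrite big1 // => k _; rewrite !subrr expr0n addr0.
have -> : \sum_(c < l.-1) (a + b * (c == 0 :> nat)%:R - (a + b * (c.+1 == 0)%:R)) ^+ 2 = b ^+ 2.
  case: (l) l2 => [//|[//|k]] _ /=; rewrite big_ord_recl /= big1 => [|i _]; last first.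
    by rewrite mulr0 subrr expr0n.
  by ring.
rewrite nR mulrAC ler_pdivlMr; last lra.
rewrite -subr_ge0.
(* Completing the square; the remaining coefficient of [b ^+ 2] is positive because l >= 2. *)
have -> : l%:R * (n%:R * ((a + b) ^+ 2 + (l%:R - 1) * a ^+ 2)) - b ^+ 2 * (n%:R - 1) =
  n%:R * (l%:R * a + b) ^+ 2 + (n%:R * (l%:R - 2) + 1) * b ^+ 2 :> R by ring.
by apply: addr_ge0; apply: mulr_ge0; rewrite ?sqr_ge0 //; nra.
Qed.
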